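(* Let $\mathbb{K}$ be a field of characteristic zero and let $A$ be a commutative Noetherian $\mathbb{K}$-algebra. Suppose that $A$ is either finitely generated over $\mathbb{K}$, or that $A$ is complete. Let $f\in A$, $\delta=\delta(s)\in D_{A|\mathbb{K}}[s]$ and $b(s)\in\mathbb{K}[s]$. Then the equality $$\delta\bullet f\boldsymbol{f^s}=b(s)\boldsymbol{f^s}$$ holds in $M^A[\boldsymbol{f^s}]$ if and only if $\delta(t)\bullet f^{t+1}=b(t)f^t$ (in $A_f$) for all $t\in\mathbb{Z}$.
   Context: $D_{A|\mathbb{K}}$ is Grothendieck's ring of $\mathbb{K}$-linear differential operators on $A$; modules are left modules with action $\bullet$; $A_f$ is a $D_{A|\mathbb{K}}$-module via the unique extension of each operator to the localization. $M^A[\boldsymbol{f^s}]=A_f[s]\boldsymbol{f^s}$ is the free rank-one $A_f[s]$-module on the formal symbol $\boldsymbol{f^s}$. For $t\in\mathbb{Z}$, $\varphi_t:M^A[\boldsymbol{f^s}]\to A_f$ is defined by $\varphi_t(h(s)\boldsymbol{f^s})=h(t)f^t$. $M^A[\boldsymbol{f^s}]$ carries the unique $D_{A|\mathbb{K}}[s]$-module structure such that $\varphi_t(\delta\bullet v)=\delta(t)\bullet\varphi_t(v)$ for all $v\in M^A[\boldsymbol{f^s}]$, $\delta\in D_{A|\mathbb{K}}[s]$, $t\in\mathbb{Z}$, where $\delta(t)$ is $\delta$ with $s$ replaced by $t$ (such a structure exists and is unique under the stated hypotheses on $A$). *)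

(* Defs.v *)
From HB Require Import structures.
From mathcomp Require Import all_boot all_order all_algebra.
From mathcomp Require Import boolp classical_sets functions.
From mathcomp Require Import ring.

Set Implicit Arguments.
Unset Strict Implicit.
Unset Printing Implicit Defensive.

Import Order.TTheory GRing.Theory Num.Theory.

Local Open Scope ring_scope.
Local Open Scope quotient_scope.
Local Open Scope classical_set_scope.

Section Conditions.
Variable A : comNzRingType.
Implicit Types I J : set A.

Definition is_ideal I :=
  [/\ I 0, (forall x y, I x -> I y -> I (x + y))
    & (forall a x, I x -> I (a * x))].

Definition ideal_span (s : seq A) : set A :=
  [set x | exists c : 'I_(size s) -> A, x = \sum_i c i * s`_i].

Definition noetherian := forall I, is_ideal I -> exists s, I = ideal_span s.

Definition is_maximal_ideal I :=
  [/\ is_ideal I, ~ I 1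
    & forall J, is_ideal J -> I `<=` J -> ~ J 1 -> J = I].

Definition ideal_mul I J : set A :=
  [set x | exists n (a b : 'I_n -> A),
    [/\ forall i, I (a i), forall i, J (b i) & x = \sum_i a i * b i]].

Fixpoint ideal_exp I n : set A :=
  if n is n'.+1 then ideal_mul I (ideal_exp I n') else setT.

Definition adic_separated I :=
  forall x, (forall n, ideal_exp I n x) -> x = 0.

(* u represents an element of the inverse limit of the A / I^n; together with
   separatedness this says that A -> lim A / I^n is bijective. *)
Definition adic_precomplete I :=
  forall u : nat -> A, (forall n, ideal_exp I n (u n.+1 - u n)) ->
  exists x, forall n, ideal_exp I n (x - u n).

Definition complete_local :=
  exists m : set A,
    [/\ is_maximal_ideal m, (forall m', is_maximal_ideal m' -> m' = m),
        adic_separated m & adic_precomplete m].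

End Conditions.

Definition finitely_generated (K : fieldType) (A : comAlgType K) :=
  exists s : seq A, forall S : {pred A},
    GRing.subalg_closed S -> {subset s <= S} -> forall a, a \in S.

(* The K-algebra R is given by its structure morphism, and R is only a
   comPzRingType, because the definition is also used for the localization A_f,
   which is the zero ring when f is nilpotent. *)
Section DiffOp.
Variables (K : fieldType) (R : comPzRingType) (kappa : {rmorphism K -> R}).
Implicit Types d e : R -> R.

Definition opcomm d (a : R) : R -> R := fun x => d (a * x) - a * d x.

(* d has order < n in Grothendieck's sense, 0 being the only operator of
   order < 0; those of order <= 0 are then the R-linear maps *)
Fixpoint order_lt n d : Prop :=
  if n is n'.+1 then forall a, order_lt n' (opcomm d a) else d = 0.

Definition K_linear d :=
  (forall x y, d (x + y) = d x + d y) /\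
  (forall c x, d (kappa c * x) = kappa c * d x).

Definition is_diffop d := K_linear d /\ exists n, order_lt n d.

Lemma opcommE d a x : opcomm d a x = d (a * x) - a * d x. Proof. by []. Qed.

Lemma order_lt0 n : order_lt n 0.
Proof.
elim: n => //= n IH a.
suff -> : opcomm 0 a = 0 by [].
by apply/funext => x; rewrite opcommE mulr0 subrr.
Qed.

Lemma order_ltS n d : order_lt n d -> order_lt n.+1 d.
Proof.
elim: n d => [d -> a|n IH d H a]; first exact: (order_lt0 1).
exact/IH/H.
Qed.

Lemma order_lt_leq m n d : (m <= n)%N -> order_lt m d -> order_lt n d.
Proof. by move=> /subnK <-; elim: (n - m)%N => // k IH /IH/order_ltS. Qed.

Lemma order_ltD n d e : order_lt n d -> order_lt n e -> order_lt n (d + e).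
Proof.
elim: n d e => [d e -> ->|n IH d e Hd He a]; first exact: addr0.
suff -> : opcomm (d + e) a = opcomm d a + opcomm e a by exact: IH.
by apply/funext => x; rewrite !(opcommE, addrfctE) mulrDr opprD addrACA.
Qed.

Lemma order_ltN n d : order_lt n d -> order_lt n (- d).
Proof.
elim: n d => [d ->|n IH d Hd a]; first exact: oppr0.
suff -> : opcomm (- d) a = - opcomm d a by exact: IH.
by apply/funext => x; rewrite !(opcommE, opprfctE) mulrN opprD.
Qed.

Lemma opcomm_comp d e a : (forall x y, d (x + y) = d x + d y) ->
  opcomm (d \o e) a = (opcomm d a \o e) + (d \o opcomm e a).
Proof.
move=> dD; have d0 : d 0 = 0 by apply: (addrI (d 0)); rewrite -dD !addr0.
have dB x y : d (x - y) = d x - d y.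
  by apply/eqP; rewrite eq_sym subr_eq -dD subrK.
apply/funext => x; rewrite addrfctE /= !opcommE dB.
by rewrite [RHS]addrC [RHS]addrA subrK.
Qed.

Lemma opcomm_additive d a : (forall x y, d (x + y) = d x + d y) ->
  forall x y, opcomm d a (x + y) = opcomm d a x + opcomm d a y.
Proof. by move=> dD x y; rewrite !opcommE !(mulrDr, dD) opprD addrACA. Qed.

Lemma order_lt_comp m n d e : (forall x y, d (x + y) = d x + d y) ->
  order_lt m d -> order_lt n e -> order_lt (m + n) (d \o e).
Proof.
have [k] := ubnP (m + n)%N; elim: k m n d e => // k IH m n d e lek dD Hd He.
have d0 : d 0 = 0 by apply: (addrI (d 0)); rewrite -dD !addr0.
case: m lek Hd => [|m] lek Hd; first by rewrite /= in Hd *; rewrite Hd; exact: order_lt0.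
case: n lek He => [|n] lek He.
  rewrite /= in He; rewrite He (_ : d \o 0 = 0); last by apply/funext.
  exact: order_lt0.
rewrite addSn => a; rewrite opcomm_comp //; apply: order_ltD.
- by apply: IH => //; exact: opcomm_additive.
- change (order_lt (m + n.+1)%N (d \o opcomm e a)).
  by rewrite -addSnnS; apply: IH => //; move: lek; rewrite addnS ltnS.
Qed.

Lemma K_linear_mul r : K_linear ( *%R r).
Proof. by split=> [x y|c x]; rewrite ?mulrDr // mulrCA. Qed.

Lemma order_lt_mul r : order_lt 1 ( *%R r).
Proof. by move=> a; apply/funext => x; rewrite opcommE mulrCA subrr. Qed.

Lemma order_lt_mull n d r : order_lt n d -> order_lt n (fun x => r * d x).
Proof.
elim: n d => [d -> /=|n IH d Hd a]; first by apply/funext => x; exact: mulr0.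
suff -> : opcomm (fun x => r * d x) a = fun x => r * opcomm d a x by exact: IH.
by apply/funext => x; rewrite !opcommE mulrBr mulrCA.
Qed.

Lemma order_lt_mulr n d r : order_lt n d -> order_lt n (fun x => d (r * x)).
Proof.
elim: n d => [d -> /=|n IH d Hd a]; first by apply/funext.
suff -> : opcomm (fun x => d (r * x)) a = fun x => opcomm d a (r * x) by exact: IH.
by apply/funext => x; rewrite !opcommE mulrCA.
Qed.

Lemma K_linearD d e : K_linear d -> K_linear e -> K_linear (d + e).
Proof.
move=> [dD dZ] [eD eZ]; split=> [x y|c x]; rewrite !addrfctE.
  by rewrite dD eD addrACA.
by rewrite dZ eZ mulrDr.
Qed.

Lemma K_linearN d : K_linear d -> K_linear (- d).
Proof.
move=> [dD dZ]; split=> [x y|c x]; rewrite !opprfctE ?dD ?opprD //.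
by rewrite dZ mulrN.
Qed.

Lemma K_linear0 : K_linear 0.
Proof. by split=> [x y|c x]; rewrite ?addr0 ?mulr0. Qed.

Lemma K_linear_comp d e : K_linear d -> K_linear e -> K_linear (d \o e).
Proof.
by move=> [dD dZ] [eD eZ]; split=> [x y|c x] /=; rewrite ?(eD, eZ) ?(dD, dZ).
Qed.

Lemma K_linear_opcomm d a : K_linear d -> K_linear (opcomm d a).
Proof.
move=> [dD dZ]; split=> [|c x]; first exact: opcomm_additive.
by rewrite !opcommE mulrCA !dZ [a * _]mulrCA mulrBr.
Qed.

Lemma is_diffop0 : is_diffop 0.
Proof. by split; [exact: K_linear0 | exists 0%N]. Qed.

Lemma is_diffopD d e : is_diffop d -> is_diffop e -> is_diffop (d + e).
Proof.
move=> [dK [m dm]] [eK [n en]]; split; first exact: K_linearD.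
exists (maxn m n); apply: order_ltD.
- exact: order_lt_leq (leq_maxl _ _) dm.
- exact: order_lt_leq (leq_maxr _ _) en.
Qed.

Lemma is_diffopN d : is_diffop d -> is_diffop (- d).
Proof.
by move=> [dK [n dn]]; split; [exact: K_linearN | exists n; exact: order_ltN].
Qed.

Lemma is_diffop_comp d e : is_diffop d -> is_diffop e -> is_diffop (d \o e).
Proof.
move=> [dK [m dm]] [eK [n en]]; split; first exact: K_linear_comp.
by exists (m + n)%N; apply: order_lt_comp => //; case: dK.
Qed.

Lemma is_diffop_id : is_diffop id.
Proof.
split; first by [].
by exists 1%N => a; apply/funext => x; rewrite opcommE subrr.
Qed.

End DiffOp.

Section DiffOpRing.
Variables (K : fieldType) (A : comAlgType K).

Record diffop := DiffOp {
  diffop_fun :> A -> A;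
  diffop_subproof : `[< is_diffop (in_alg A : {rmorphism K -> A}) diffop_fun >]
}.
HB.instance Definition _ := [isSub for diffop_fun].
HB.instance Definition _ := [Choice of diffop by <:].

Lemma diffopP (d : diffop) : is_diffop (in_alg A : {rmorphism K -> A}) d.
Proof. by case: d => d /= /asboolP. Qed.

Definition mk_diffop d (H : is_diffop (in_alg A : {rmorphism K -> A}) d) : diffop :=
  DiffOp (asboolT H).

Lemma diffop_ext (d e : diffop) : d =1 e -> d = e.
Proof. by move=> H; apply: val_inj; apply/funext. Qed.

Definition diffop_zero := mk_diffop (is_diffop0 _).
Definition diffop_opp d := mk_diffop (is_diffopN (diffopP d)).
Definition diffop_add d e := mk_diffop (is_diffopD (diffopP d) (diffopP e)).
Definition diffop_one := mk_diffop (is_diffop_id _).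
Definition diffop_mul d e := mk_diffop (is_diffop_comp (diffopP d) (diffopP e)).

Fact diffop_addA : associative diffop_add.
Proof. by move=> d e g; apply: diffop_ext => x; exact: addrA. Qed.
Fact diffop_addC : commutative diffop_add.
Proof. by move=> d e; apply: diffop_ext => x; exact: addrC. Qed.
Fact diffop_add0 : left_id diffop_zero diffop_add.
Proof. by move=> d; apply: diffop_ext => x; exact: add0r. Qed.
Fact diffop_addN : left_inverse diffop_zero diffop_opp diffop_add.
Proof. by move=> d; apply: diffop_ext => x; exact: addNr. Qed.
HB.instance Definition _ := GRing.isZmodule.Build diffop
  diffop_addA diffop_addC diffop_add0 diffop_addN.

Fact diffop_mulA : associative diffop_mul.
Proof. by move=> d e g; apply: diffop_ext. Qed.
Fact diffop_mul1 : left_id diffop_one diffop_mul.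
Proof. by move=> d; apply: diffop_ext. Qed.
Fact diffop_mulr1 : right_id diffop_one diffop_mul.
Proof. by move=> d; apply: diffop_ext. Qed.
Fact diffop_mulDl : left_distributive diffop_mul +%R.
Proof. by move=> d e g; apply: diffop_ext. Qed.
Fact diffop_mulDr : right_distributive diffop_mul +%R.
Proof.
by move=> d e g; apply: diffop_ext => x /=; case: (diffopP d) => -[dD _] _; exact: dD.
Qed.
Fact diffop_1neq0 : diffop_one != 0.
Proof.
by apply/eqP => /(congr1 (fun d : diffop => d 1))/eqP; rewrite /= oner_eq0.
Qed.
HB.instance Definition _ := GRing.Zmodule_isNzRing.Build diffop
  diffop_mulA diffop_mul1 diffop_mulr1 diffop_mulDl diffop_mulDr diffop_1neq0.

Lemma diffop0E x : (0 : diffop) x = 0. Proof. by []. Qed.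
Lemma diffopDE (d e : diffop) x : (d + e) x = d x + e x. Proof. by []. Qed.
Lemma diffop1E x : (1 : diffop) x = x. Proof. by []. Qed.
Lemma diffopME (d e : diffop) x : (d * e) x = d (e x). Proof. by []. Qed.

End DiffOpRing.

Notation "''D[' K ] A" := (@diffop K A)
  (at level 8, A at level 2, format "''D[' K ]  A").

Section Localization.
Variables (R : comPzRingType) (f : R).

(* (a, n) stands for a / f ^ n *)
Definition loc_rel (x y : R * nat) : bool :=
  `[< exists k, f ^+ k * (f ^+ y.2 * x.1 - f ^+ x.2 * y.1) = 0 >].

Fact loc_rel_refl : reflexive loc_rel.
Proof. by move=> x; apply/asboolP; exists 0%N; rewrite subrr mulr0. Qed.

Fact loc_rel_sym : symmetric loc_rel.
Proof.
suff H x y : loc_rel x y -> loc_rel y x by move=> x y; apply/idP/idP; exact: H.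
move=> /asboolP[k Hk]; apply/asboolP; exists k.
by rewrite -opprB mulrN Hk oppr0.
Qed.

Fact loc_rel_trans : transitive loc_rel.
Proof.
move=> y x z /asboolP[j Hj] /asboolP[k Hk]; apply/asboolP.
exists (j + k + y.2)%N; rewrite !exprD.
rewrite [LHS](_ : _ =
  f ^+ k * f ^+ z.2 * (f ^+ j * (f ^+ y.2 * x.1 - f ^+ x.2 * y.1)) +
  f ^+ j * f ^+ x.2 * (f ^+ k * (f ^+ z.2 * y.1 - f ^+ y.2 * z.1))); last by ring.
by rewrite Hj Hk !mulr0 addr0.
Qed.

Canonical loc_equiv := EquivRel loc_rel loc_rel_refl loc_rel_sym loc_rel_trans.

Definition loc := {eq_quot loc_equiv}.
HB.instance Definition _ := EqQuotient.on loc.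
HB.instance Definition _ := Choice.on loc.

Definition frac (a : R) (n : nat) : loc := \pi_loc (a, n).

Lemma frac_eq a n b m :
  frac a n = frac b m <-> exists k, f ^+ k * (f ^+ m * a - f ^+ n * b) = 0.
Proof.
split=> [/eqmodP/asboolP //|H]; apply/eqmodP.
exact/asboolP.
Qed.

Lemma locW (P : loc -> Prop) : (forall a n, P (frac a n)) -> forall x, P x.
Proof. by move=> H; apply: quotW => -[a n]; exact: H. Qed.

Definition num (x : loc) := (repr x).1.
Definition den (x : loc) := (repr x).2.
Lemma num_den x : x = frac (num x) (den x).
Proof. by rewrite /frac -surjective_pairing reprK. Qed.

Lemma num_denP a n :
  exists k, f ^+ k * (f ^+ n * num (frac a n) - f ^+ den (frac a n) * a) = 0.
Proof. by apply/frac_eq; rewrite -num_den. Qed.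

Definition loc_add (x y : loc) :=
  frac (f ^+ den y * num x + f ^+ den x * num y) (den x + den y).
Definition loc_mul (x y : loc) := frac (num x * num y) (den x + den y).
Definition loc_opp (x : loc) := frac (- num x) (den x).

Fact loc_addE a n b m :
  loc_add (frac a n) (frac b m) = frac (f ^+ m * a + f ^+ n * b) (n + m).
Proof.
apply/frac_eq; have [k Hk] := num_denP a n; have [l Hl] := num_denP b m.
set x := num _ in Hk *; set p := den _ in Hk *.
set y := num _ in Hl *; set q := den _ in Hl *.
exists (k + l)%N; rewrite !exprD.
rewrite [LHS](_ : _ =
  f ^+ q * f ^+ m * f ^+ l * (f ^+ k * (f ^+ n * x - f ^+ p * a)) +
  f ^+ p * f ^+ n * f ^+ k * (f ^+ l * (f ^+ m * y - f ^+ q * b))); last by ring.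
by rewrite Hk Hl !mulr0 addr0.
Qed.

Fact loc_mulE a n b m :
  loc_mul (frac a n) (frac b m) = frac (a * b) (n + m).
Proof.
apply/frac_eq; have [k Hk] := num_denP a n; have [l Hl] := num_denP b m.
set x := num _ in Hk *; set p := den _ in Hk *.
set y := num _ in Hl *; set q := den _ in Hl *.
exists (k + l)%N; rewrite !exprD.
rewrite [LHS](_ : _ =
  y * f ^+ m * f ^+ l * (f ^+ k * (f ^+ n * x - f ^+ p * a)) +
  f ^+ p * a * f ^+ k * (f ^+ l * (f ^+ m * y - f ^+ q * b))); last by ring.
by rewrite Hk Hl !mulr0 addr0.
Qed.

Fact loc_oppE a n : loc_opp (frac a n) = frac (- a) n.
Proof.
apply/frac_eq; have [k Hk] := num_denP a n; exists k.
by apply: oppr_inj; rewrite oppr0 -Hk; ring.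
Qed.

Lemma frac_eqW a n b m : f ^+ m * a = f ^+ n * b -> frac a n = frac b m.
Proof. by move=> H; apply/frac_eq; exists 0%N; rewrite H subrr mulr0. Qed.

Fact loc_addA : associative loc_add.
Proof.
move=> x y z; elim/locW: x => a n; elim/locW: y => b m; elim/locW: z => c p.
by rewrite !loc_addE; apply: frac_eqW; rewrite !exprD; ring.
Qed.
Fact loc_addC : commutative loc_add.
Proof.
move=> x y; elim/locW: x => a n; elim/locW: y => b m.
by rewrite !loc_addE; apply: frac_eqW; rewrite !exprD; ring.
Qed.
Fact loc_add0 : left_id (frac 0 0) loc_add.
Proof.
move=> x; elim/locW: x => a n.
by rewrite !loc_addE; apply: frac_eqW; rewrite !exprD expr0; ring.
Qed.
Fact loc_addN : left_inverse (frac 0 0) loc_opp loc_add.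
Proof.
move=> x; elim/locW: x => a n.
by rewrite loc_oppE !loc_addE; apply: frac_eqW; rewrite !exprD expr0; ring.
Qed.
HB.instance Definition _ := GRing.isZmodule.Build loc
  loc_addA loc_addC loc_add0 loc_addN.

Fact loc_mulA : associative loc_mul.
Proof.
move=> x y z; elim/locW: x => a n; elim/locW: y => b m; elim/locW: z => c p.
by rewrite !loc_mulE; apply: frac_eqW; rewrite !exprD; ring.
Qed.
Fact loc_mulC : commutative loc_mul.
Proof.
move=> x y; elim/locW: x => a n; elim/locW: y => b m.
by rewrite !loc_mulE; apply: frac_eqW; rewrite !exprD; ring.
Qed.
Fact loc_mul1 : left_id (frac 1 0) loc_mul.
Proof.
move=> x; elim/locW: x => a n.
by rewrite !loc_mulE; apply: frac_eqW; rewrite !exprD expr0; ring.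
Qed.
Fact loc_mulDl : left_distributive loc_mul loc_add.
Proof.
move=> x y z; elim/locW: x => a n; elim/locW: y => b m; elim/locW: z => c p.
by rewrite !(loc_mulE, loc_addE); apply: frac_eqW; rewrite !exprD; ring.
Qed.
HB.instance Definition _ := GRing.Zmodule_isComPzRing.Build loc
  loc_mulA loc_mulC loc_mul1 loc_mulDl.

Definition to_loc (a : R) : loc := frac a 0.

Lemma fracD a n b m : frac a n + frac b m = frac (f ^+ m * a + f ^+ n * b) (n + m).
Proof. exact: loc_addE. Qed.
Lemma fracM a n b m : frac a n * frac b m = frac (a * b) (n + m).
Proof. exact: loc_mulE. Qed.

Fact to_loc_is_zmod_morphism : zmod_morphism to_loc.
Proof.
move=> a b; rewrite /to_loc [- frac b 0]loc_oppE fracD.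
by rewrite expr0 !mul1r.
Qed.
Fact to_loc_is_monoid_morphism : monoid_morphism to_loc.
Proof. by split=> // a b; rewrite fracM. Qed.
HB.instance Definition _ := GRing.isZmodMorphism.Build R loc to_loc
  to_loc_is_zmod_morphism.
HB.instance Definition _ := GRing.isMonoidMorphism.Build R loc to_loc
  to_loc_is_monoid_morphism.

Definition locf : loc := to_loc f.
Definition locfV : loc := frac 1 1.

Lemma locfVK : locf * locfV = 1.
Proof. by rewrite fracM; apply: frac_eqW; rewrite !expr1 expr0; ring. Qed.

Lemma fracE a n : frac a n = to_loc a * locfV ^+ n.
Proof.
elim: n => [|n IH]; first by rewrite expr0 mulr1.
by rewrite exprSr mulrA -IH fracM mulr1 addn1.
Qed.

Lemma locfK n x : locf ^+ n * (locfV ^+ n * x) = x.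
Proof. by rewrite mulrA -exprMn locfVK expr1n mul1r. Qed.

Lemma locfVK' n x : locfV ^+ n * (locf ^+ n * x) = x.
Proof. by rewrite mulrCA locfK. Qed.

Lemma locf_inj n x y : locf ^+ n * x = locf ^+ n * y -> x = y.
Proof. by move=> H; rewrite -[x](locfVK' n) H locfVK'. Qed.

(* f ^ t in A_f; the library's integer powers need a nonzero ring *)
Definition locf_exp (t : int) : loc :=
  match t with Posz n => locf ^+ n | Negz n => locfV ^+ n.+1 end.

Lemma locf_expS t : locf_exp (t + 1) = locf * locf_exp t.
Proof.
case: t => [n|[|n]].
- have -> : Posz n + 1 = Posz n.+1 by rewrite -addn1 PoszD.
  by rewrite /= exprS.
- by rewrite (_ : Negz 0 + 1 = 0) //= expr1 locfVK.
- have -> : Negz n.+1 + 1 = Negz n by rewrite !NegzE -[n.+2]addn1 PoszD opprD subrK.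
  by rewrite /= [locfV ^+ n.+2]exprS mulrA locfVK mul1r.
Qed.

Lemma to_loc_eq0 a : to_loc a = 0 -> exists k, f ^+ k * a = 0.
Proof.
move=> /frac_eq[k]; rewrite expr0 mul1r mulr0 subr0 => H; by exists k.
Qed.

End Localization.

Section Extension.
Variables (K : fieldType) (R : comPzRingType) (kappa : {rmorphism K -> R}).
Variable f : R.
Local Notation L := (loc f).
Local Notation i := (@to_loc R f).
Local Notation g := (locf f).
Local Notation kappaL := (i \o kappa : {rmorphism K -> L}).
Implicit Types (d : R -> R) (E : L -> L).

Fact opcomm_to_loc d E b : (forall a, E (i a) = i (d a)) ->
  forall a, opcomm E (i b) (i a) = i (opcomm d b a).
Proof. by move=> H a; rewrite !opcommE -rmorphM !H rmorphB rmorphM. Qed.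

Fact ext_uniq0 n E : order_lt n E -> (forall a, E (i a) = 0) -> E = 0.
Proof.
elim: n E => // n IH E En E0.
have comm0 b : opcomm E (i b) = 0.
  by apply: IH => [|a]; [exact: En | rewrite opcommE -rmorphM !E0 mulr0 subrr].
apply/funext => x; elim/locW: x => a k.
have /(congr1 (fun h => h (frac f a k))) := comm0 (f ^+ k).
rewrite opcommE rmorphXn /= -/g {1}fracE [i a * _]mulrC locfK E0 sub0r.
by move/eqP; rewrite oppr_eq0 => /eqP H; apply: (@locf_inj _ f k); rewrite H mulr0.
Qed.

Fact ext_uniq m n E E' : order_lt m E -> order_lt n E' ->
  (forall a, E (i a) = E' (i a)) -> E = E'.
Proof.
move=> Em En H; apply/eqP; rewrite -subr_eq0; apply/eqP.
apply: (@ext_uniq0 (maxn m n)).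
  apply: order_ltD; first exact: order_lt_leq (leq_maxl _ _) Em.
  by apply: order_ltN; exact: order_lt_leq (leq_maxr _ _) En.
by move=> a; rewrite addrfctE opprfctE H subrr.
Qed.

Fact order_lt_loc n E : (forall b, order_lt n (opcomm E (i b))) -> order_lt n.+1 E.
Proof.
move=> H r; elim/locW: r => b k.
have -> : opcomm E (frac f b k) = fun x => locfV f ^+ k *
    (opcomm E (i b) - (fun y => opcomm E (i (f ^+ k)) (frac f b k * y))) x.
  apply/funext => x; rewrite addrfctE opprfctE !opcommE mulrA.
  have e : i (f ^+ k) * frac f b k = i b.
    by rewrite fracE [i b * _]mulrC rmorphXn locfK.
  rewrite e; transitivity (locfV f ^+ k * (i (f ^+ k) * E (frac f b k * x) - i b * E x)).
    by rewrite -e -mulrA -mulrBr rmorphXn locfVK'.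
  by congr (_ * _); ring.
apply: order_lt_mull; apply: order_ltD => //.
by apply: order_ltN; apply: order_lt_mulr.
Qed.

(* E is the extension of d to A_f; it exists and is unique (loc_act_exists,
   loc_act_uniq) *)
Definition extends d E :=
  is_diffop kappaL E /\ (forall a, E (i a) = i (d a)).

Lemma opcommC d a b : opcomm (opcomm d a) b = opcomm (opcomm d b) a.
Proof.
by apply/funext => x; rewrite !opcommE [b * (a * x)]mulrCA; ring.
Qed.

Fact ext_exists n d : K_linear kappa d -> order_lt n d ->
  exists E, [/\ K_linear kappaL E, order_lt n E & forall a, E (i a) = i (d a)].
Proof.
elim: n d => [d dK ->|n IH d dK dn].
  by exists 0; split=> //; exact: K_linear0.
have dD := dK.1.
have /choice[F FP] : forall b, exists E, [/\ K_linear kappaL E, order_lt n E &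
    forall a, E (i a) = i (opcomm d b a)].
  by move=> b; apply: IH; [exact: K_linear_opcomm | exact: dn].
have FD b : forall x y, F b (x + y) = F b x + F b y by have [[]] := FP b.
have FZ b : forall c x, F b (kappaL c * x) = kappaL c * F b x by have [[]] := FP b.
have Fn b : order_lt n (F b) by have [] := FP b.
have Fi b : forall a, F b (i a) = i (opcomm d b a) by have [] := FP b.
have F0 b : F b 0 = 0 by apply: (addrI (F b 0)); rewrite -FD !addr0.
have dB x y : d (x - y) = d x - d y.
  by apply/eqP; rewrite eq_sym subr_eq -dD subrK.
have FM p q x : F (p * q) x = F p (i q * x) + i p * F q x.
  have -> : F (p * q) = (fun x => F p (i q * x)) + (fun x => i p * F q x).
    apply: (ext_uniq (Fn _)) => [|a].
      by apply: order_ltD; [apply: order_lt_mulr | apply: order_lt_mull].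
    rewrite addrfctE -rmorphM !Fi -rmorphM -rmorphD; congr (i _).
    by rewrite !opcommE mulrBr !mulrA addrA subrK.
  by rewrite addrfctE.
have fracK a k : i (f ^+ k) * frac f a k = i a.
  by rewrite fracE [i a * _]mulrC rmorphXn locfK.
pose E x := locfV f ^+ den x * (i (d (num x)) - F (f ^+ den x) x).
have key a k : i (f ^+ k) * E (frac f a k) = i (d a) - F (f ^+ k) (frac f a k).
  set x := frac f a k.
  have [j Hj] := num_denP f a k; rewrite -/x in Hj.
  have xi : x = frac f (num x) (den x) by exact: num_den.
  set b := num x in Hj xi *; set m := den x in Hj xi *.
  have H1 : i (f ^+ m) * (i (d a) - F (f ^+ k) x) =
            i (d (f ^+ m * a)) - F (f ^+ m * f ^+ k) x.
    rewrite FM {2}/x fracK Fi opcommE rmorphB !rmorphM.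
    by ring.
  have H2 : i (f ^+ k) * (i (d b) - F (f ^+ m) x) =
            i (d (f ^+ k * b)) - F (f ^+ m * f ^+ k) x.
    have fx : i (f ^+ m) * x = i b by rewrite xi fracK.
    rewrite [f ^+ m * _]mulrC FM fx Fi opcommE rmorphB !rmorphM.
    by ring.
  have H3 : i (d (f ^+ m * a)) = i (d (f ^+ k * b)).
    apply/eqP; rewrite eq_sym -subr_eq0 -rmorphB -dB; apply/eqP.
    set e := (_ - _) in Hj *.
    have ie0 : i e = 0 by apply: (@locf_inj _ f j); rewrite -rmorphXn -rmorphM Hj rmorph0 mulr0.
    have := Fi (f ^+ j) e; rewrite ie0 F0 opcommE Hj.
    have -> : d 0 = 0 by apply: (addrI (d 0)); rewrite -dD !addr0.
    rewrite sub0r rmorphN rmorphM => /esym/eqP; rewrite oppr_eq0 => /eqP H.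
    by apply: (@locf_inj _ f j); rewrite mulr0 -H rmorphXn.
  apply: (@locf_inj _ f m); rewrite /E -/m -/b.
  rewrite [_ * (i (f ^+ k) * _)]mulrCA [_ * (locfV f ^+ m * _)]mulrA.
  rewrite -exprMn locfVK expr1n mul1r H2 -H3 -H1 rmorphXn //.
have common x y : exists a b k, x = frac f a k /\ y = frac f b k.
  elim/locW: x => a k; elim/locW: y => b m.
  exists (f ^+ m * a), (f ^+ k * b), (k + m)%N.
  by split; apply: frac_eqW; rewrite !exprD; ring.
have fracDk a b k : frac f a k + frac f b k = frac f (a + b) k.
  by rewrite fracD; apply: frac_eqW; rewrite !exprD; ring.
have ED x y : E (x + y) = E x + E y.
  have [a [b [k [-> ->]]]] := common x y.
  apply: (@locf_inj _ f k); rewrite -rmorphXn -/(i _) mulrDr fracDk !key -fracDk.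
  by rewrite FD dD rmorphD opprD addrACA.
have iM c a k : i c * frac f a k = frac f (c * a) k by rewrite fracM add0n.
have Ei a : E (i a) = i (d a).
  have := key a 0%N; rewrite expr0 rmorph1 mul1r => ->.
  by rewrite Fi opcommE !mul1r subrr rmorph0 subr0.
exists E; split=> //.
- split=> // c x; elim/locW: x => a k.
  have H : F (f ^+ k) (i (kappa c) * frac f a k) = i (kappa c) * F (f ^+ k) (frac f a k).
    exact: FZ.
  change (E (i (kappa c) * frac f a k) = i (kappa c) * E (frac f a k)).
  apply: (@locf_inj _ f k); rewrite -rmorphXn [RHS]mulrCA iM !key -iM H.
  by rewrite mulrBr dK.2 rmorphM.
- apply: order_lt_loc => b.
  suff -> : opcomm E (i b) = F b by [].
  apply/funext => x; elim/locW: x => a k.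
  apply: (@locf_inj _ f k); rewrite -rmorphXn opcommE mulrBr [_ * (i b * _)]mulrCA.
  have ibx := iM b a k; rewrite ibx (key (b * a)) (key a) -ibx.
  have FC : opcomm (F (f ^+ k)) (i b) = opcomm (F b) (i (f ^+ k)).
    apply: (@ext_uniq n n).
    - case: (n) (Fn (f ^+ k)) => [-> |m Hm]; first by apply/funext => y; rewrite opcommE mulr0 subrr.
      exact: (order_ltS (Hm _)).
    - case: (n) (Fn b) => [-> |m Hm]; first by apply/funext => y; rewrite opcommE mulr0 subrr.
      exact: (order_ltS (Hm _)).
    - move=> c; rewrite (opcomm_to_loc _ (Fi _)) (opcomm_to_loc _ (Fi _)).
      by rewrite opcommC.
  have := congr1 (fun h => h (frac f a k)) FC; rewrite !opcommE fracK Fi opcommE => FC'.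
  rewrite mulrBr rmorphB rmorphM in FC' *.
  apply/eqP; rewrite -subr_eq0.
  move/eqP: FC'; rewrite -subr_eq0 => /eqP FC'.
  apply/eqP; apply: oppr_inj; rewrite oppr0 -[RHS]FC'.
  by ring.
Qed.

End Extension.

Section LocAction.
Variables (K : fieldType) (A : comAlgType K) (f : A).
Local Notation kappaA := (in_alg A : {rmorphism K -> A}).

Lemma loc_act_exists (d : 'D[K] A) : exists E : loc f -> loc f, extends kappaA d E.
Proof.
have [dK [n dn]] := diffopP d.
have [E [EK En Ei]] := ext_exists f dK dn.
by exists E; split=> //; split=> //; exists n.
Qed.

Lemma loc_act_uniq (d : 'D[K] A) (E E' : loc f -> loc f) :
  extends kappaA d E -> extends kappaA d E' -> E = E'.
Proof.
move=> [[_ [n En]] Ei] [[_ [m Em]] Ei'].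
by apply: (ext_uniq En Em) => a; rewrite Ei Ei'.
Qed.

Definition loc_act (d : 'D[K] A) : loc f -> loc f := sval (cid (loc_act_exists d)).

Lemma loc_actP (d : 'D[K] A) : extends kappaA d (loc_act d).
Proof. exact: svalP (cid (loc_act_exists d)). Qed.

Lemma loc_act_additive (d : 'D[K] A) x y : loc_act d (x + y) = loc_act d x + loc_act d y.
Proof. by have [[[H _] _] _] := loc_actP d; exact: H. Qed.

Lemma loc_actD (d e : 'D[K] A) x : loc_act (d + e) x = loc_act d x + loc_act e x.
Proof.
suff -> : loc_act (d + e) = loc_act d + loc_act e by [].
apply: (loc_act_uniq (loc_actP _)).
have [dP di] := loc_actP d; have [eP ei] := loc_actP e.
by split=> [|a]; [exact: is_diffopD | rewrite addrfctE di ei -rmorphD].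
Qed.

Lemma loc_act1 x : loc_act 1 x = x.
Proof.
suff -> : loc_act 1 = id by [].
apply: (loc_act_uniq (loc_actP _)).
by split=> [|a //]; exact: is_diffop_id.
Qed.

Lemma loc_actM (d e : 'D[K] A) x : loc_act (d * e) x = loc_act d (loc_act e x).
Proof.
suff -> : loc_act (d * e) = loc_act d \o loc_act e by [].
apply: (loc_act_uniq (loc_actP _)).
have [dP di] := loc_actP d; have [eP ei] := loc_actP e.
by split=> [|a]; [exact: is_diffop_comp | rewrite /= ei di].
Qed.

End LocAction.

Arguments loc_act {K A} f d x.
Arguments loc_actP {K A} f d.

(* [{poly R}] requires 1 != 0 in R, which fails for R = A_f, f nilpotent. *)
Section FPoly.
Variable R : comPzRingType.

Record fpoly := FPoly {
  fcoef :> nat -> R;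
  fpoly_subproof : `[< exists n, forall k, (n <= k)%N -> fcoef k = 0 >]
}.
HB.instance Definition _ := [isSub for fcoef].
HB.instance Definition _ := [Choice of fpoly by <:].
Implicit Types p q r : fpoly.

Definition mk_fpoly (c : nat -> R)
    (H : exists n, forall k, (n <= k)%N -> c k = 0) : fpoly := FPoly (asboolT H).

Lemma fpolyP p : exists n, forall k, (n <= k)%N -> p k = 0.
Proof. by case: p => p /= /asboolP. Qed.

Definition fbound p : nat := sval (cid (fpolyP p)).
Lemma fboundP p k : (fbound p <= k)%N -> p k = 0.
Proof. exact: (svalP (cid (fpolyP p))). Qed.

Lemma fpoly_ext p q : p =1 q -> p = q.
Proof. by move=> H; apply: val_inj; apply/funext. Qed.

Fact fconst_subproof (c : R) :
  exists n, forall k, (n <= k)%N -> (if k == 0 then c else 0) = 0.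
Proof. by exists 1%N; case. Qed.
Definition fconst c : fpoly := mk_fpoly (fconst_subproof c).

Fact fopp_subproof p : exists n, forall k, (n <= k)%N -> - p k = 0.
Proof. by have [n H] := fpolyP p; exists n => k /H ->; rewrite oppr0. Qed.
Definition fopp p : fpoly := mk_fpoly (fopp_subproof p).

Fact fadd_subproof p q : exists n, forall k, (n <= k)%N -> p k + q k = 0.
Proof.
have [n Hp] := fpolyP p; have [m Hq] := fpolyP q; exists (maxn n m) => k.
by rewrite geq_max => /andP[/Hp -> /Hq ->]; rewrite addr0.
Qed.
Definition fadd p q : fpoly := mk_fpoly (fadd_subproof p q).

Fact fmul_subproof p q :
  exists n, forall k, (n <= k)%N -> \sum_(j < k.+1) p j * q (k - j)%N = 0.
Proof.
have [n Hp] := fpolyP p; have [m Hq] := fpolyP q; exists (n + m)%N => k le_k.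
apply: big1 => j _; have [/Hp -> |lt_jn] := leqP n j; first by rewrite mul0r.
rewrite Hq ?mulr0 // leq_subRL; last exact: leq_ord.
by rewrite (leq_trans _ le_k) // leq_add2r ltnW.
Qed.
Definition fmul p q : fpoly := mk_fpoly (fmul_subproof p q).

Fact fadd_A : associative fadd.
Proof. by move=> p q r; apply: fpoly_ext => k; exact: addrA. Qed.
Fact fadd_C : commutative fadd.
Proof. by move=> p q; apply: fpoly_ext => k; exact: addrC. Qed.
Fact fadd_0 : left_id (fconst 0) fadd.
Proof. by move=> p; apply: fpoly_ext => k /=; case: eqP; rewrite add0r. Qed.
Fact fadd_N : left_inverse (fconst 0) fopp fadd.
Proof. by move=> p; apply: fpoly_ext => k /=; rewrite addNr; case: eqP. Qed.
HB.instance Definition _ := GRing.isZmodule.Build fpoly fadd_A fadd_C fadd_0 fadd_N.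

Fact fmul_C : commutative fmul.
Proof.
move=> p q; apply: fpoly_ext => k /=; rewrite (reindex_inj rev_ord_inj) /=.
by apply: eq_bigr => j _; rewrite subSS subKn ?leq_ord // mulrC.
Qed.
Fact fmul_rev p q k : fmul p q k = \sum_(j < k.+1) p (k - j)%N * q j.
Proof. by rewrite fmul_C /=; apply: eq_bigr => j _; rewrite mulrC. Qed.
Fact fmul_A : associative fmul.
Proof.
move=> p q r; apply: fpoly_ext => i; rewrite [RHS]fmul_rev [LHS]/=.
pose coef3 j k := p j * (q (i - j - k)%N * r k).
transitivity (\sum_(j < i.+1) \sum_(k < i.+1 | (k <= i - j)%N) coef3 j k).
  apply: eq_bigr => /= j _; rewrite -[\sum_(_ < _) _]/(fmul q r (i - j)%N) fmul_rev big_distrr /=.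
  by rewrite (big_ord_narrow_leq (leq_subr _ _)).
rewrite (exchange_big_dep predT) //=; apply: eq_bigr => k _.
transitivity (\sum_(j < i.+1 | (j <= i - k)%N) coef3 j k).
  apply: eq_bigl => j; rewrite -ltnS -(ltnS j) -!subSn ?leq_ord //.
  by rewrite -subn_gt0 -(subn_gt0 j) -!subnDA addnC.
rewrite (big_ord_narrow_leq (leq_subr _ _)) big_distrl /=.
by apply: eq_bigr => j _; rewrite /coef3 -!subnDA addnC mulrA.
Qed.
Fact fmul_1 : left_id (fconst 1) fmul.
Proof.
move=> p; apply: fpoly_ext => k /=; rewrite big_ord_recl /= subn0 mul1r.
by rewrite big1 ?addr0 // => j _; rewrite mul0r.
Qed.
Fact fmul_Dl : left_distributive fmul fadd.
Proof.
move=> p q r; apply: fpoly_ext => k /=; rewrite -big_split.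
by apply: eq_bigr => j _; rewrite mulrDl.
Qed.
HB.instance Definition _ := GRing.Zmodule_isComPzRing.Build fpoly
  fmul_A fmul_C fmul_1 fmul_Dl.

Definition feval p (x : R) : R := \sum_(k < fbound p) p k * x ^+ k.

Lemma fevalE n p x : (forall k, (n <= k)%N -> p k = 0) ->
  feval p x = \sum_(k < n) p k * x ^+ k.
Proof.
have H m m' : (m <= m')%N -> (forall k, (m <= k)%N -> p k = 0) ->
    \sum_(k < m) p k * x ^+ k = \sum_(k < m') p k * x ^+ k.
  move=> lem Hm; rewrite (big_ord_widen m' (fun k => p k * x ^+ k)) // big_mkcond.
  by apply: eq_bigr => k _; case: ltnP => // /Hm ->; rewrite mul0r.
move=> Hn; rewrite /feval (H _ _ (leq_maxl (fbound p) n)); last exact: fboundP.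
by rewrite [RHS](H _ _ (leq_maxr (fbound p) n)).
Qed.

Lemma fevalD p q x : feval (p + q) x = feval p x + feval q x.
Proof.
have [n Hp] := fpolyP p; have [m Hq] := fpolyP q.
have {}Hp k : (maxn n m <= k)%N -> p k = 0 by rewrite geq_max => /andP[/Hp].
have {}Hq k : (maxn n m <= k)%N -> q k = 0 by rewrite geq_max => /andP[_ /Hq].
rewrite (fevalE _ Hp) (fevalE _ Hq) (@fevalE (maxn n m)) => [|k le_k].
  by rewrite -big_split; apply: eq_bigr => k _; exact: mulrDl.
by rewrite -[LHS]/(p k + q k) Hp ?Hq ?addr0.
Qed.

Lemma feval_const c x : feval (fconst c) x = c.
Proof.
by rewrite (@fevalE 1%N) => [|[]//]; rewrite big_ord_recl big_ord0 addr0 expr0 mulr1.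
Qed.

Lemma fevalM p q x : feval (p * q) x = feval p x * feval q x.
Proof.
have [n Hp] := fpolyP p; have [m Hq] := fpolyP q.
rewrite (@fevalE (n + m)%N) => [|k le_k]; last first.
  apply: big1 => j _; have [/Hp -> |lt_jn] := leqP n j; first by rewrite mul0r.
  rewrite Hq ?mulr0 // leq_subRL; last exact: leq_ord.
  by rewrite (leq_trans _ le_k) // leq_add2r ltnW.
have Hpn k : (n + m <= k)%N -> p k = 0.
  by move=> le_k; apply: Hp; apply: leq_trans le_k; exact: leq_addr.
rewrite (fevalE _ Hpn) big_distrl /=.
transitivity (\sum_(k < n + m) \sum_(i < n + m | (i <= k)%N)
    p i * x ^+ i * (q (k - i)%N * x ^+ (k - i))).
  apply: eq_bigr => k _.
  transitivity ((\sum_(j < k.+1) p j * q (k - j)%N) * x ^+ k); first by [].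
  rewrite big_distrl /=.
  rewrite (big_ord_widen (n + m) (fun j => p j * q (k - j)%N * x ^+ k)) //.
  apply: eq_bigr => j; rewrite ltnS => le_jk.
  have -> : x ^+ k = x ^+ j * x ^+ (k - j) by rewrite -exprD subnKC.
  by ring.
rewrite (exchange_big_dep predT) //=; apply: eq_bigr => i _.
have [/Hp pi0|lt_in] := leqP n i.
  by rewrite pi0 !mul0r big1 // => k _; rewrite !mul0r.
rewrite -big_distrr /=; congr (_ * _).
have Hqm k : (n + m - i <= k)%N -> q k = 0.
  move=> le_k; apply: Hq; apply: leq_trans le_k.
  by rewrite leq_subRL ?leq_add2r ltnW // ltn_addr.
rewrite (fevalE _ Hqm) -(big_mkord xpredT (fun j => q j * x ^+ j)).
rewrite -(big_mkord (fun k => (i <= k)%N) (fun k => q (k - i)%N * x ^+ (k - i))).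
rewrite big_mkcond (big_cat_nat (n := i)) //=; last by rewrite ltnW // ltn_addr.
rewrite big_nat big1 ?add0r => [|k /andP[_ lt_ki]]; last by rewrite leqNgt lt_ki.
rewrite -{1}[i : nat]add0n big_addn; apply: eq_bigr => k _.
by rewrite leq_addl addnK.
Qed.

Lemma feval0 x : feval 0 x = 0. Proof. exact: feval_const. Qed.

Lemma feval_sum (I : Type) (s : seq I) (P : pred I) (F : I -> fpoly) x :
  feval (\sum_(j <- s | P j) F j) x = \sum_(j <- s | P j) feval (F j) x.
Proof. by apply: (big_morph (feval ^~ x)) => [p q|]; [exact: fevalD | exact: feval0]. Qed.

Section Map.
Variables (K : fieldType) (kappa : {rmorphism K -> R}).

Fact fmap_subproof (b : {poly K}) : exists n, forall k, (n <= k)%N -> kappa b`_k = 0.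
Proof. by exists (size b) => k le_k; rewrite nth_default // rmorph0. Qed.
Definition fmap (b : {poly K}) : fpoly := mk_fpoly (fmap_subproof b).

Lemma feval_map b c : feval (fmap b) (kappa c) = kappa b.[c].
Proof.
rewrite (@fevalE (size b)) => [|k le_k]; last by rewrite /= nth_default // rmorph0.
rewrite horner_coef rmorph_sum; apply: eq_bigr => k _.
by rewrite rmorphM rmorphXn.
Qed.
End Map.

End FPoly.

Section BernsteinSato.
Variables (K : fieldType) (A : comAlgType K) (f : A).
Local Notation L := (loc f).

Definition loc_scalar : K -> L := @to_loc A f \o in_alg A.
HB.instance Definition _ := GRing.RMorphism.on loc_scalar.

(* A_f[s] as a free module of rank one over itself, with basis fs = 1 *)
Definition Mfs : Type := (fpoly L)^o.
HB.instance Definition _ := GRing.Lmodule.on Mfs.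
Definition fs : Mfs := (1 : fpoly L).

(* h(s) fs |-> h(t) f^t, see phiE *)
Definition phi (t : int) (v : Mfs) : L := feval (v : fpoly L) t%:~R * locf_exp f t.

Lemma phiE t (h : fpoly L) : phi t (h *: fs) = feval h t%:~R * locf_exp f t.
Proof. by rewrite /phi -[_ *: _]/(h * 1) mulr1. Qed.

Lemma MfsE (v : Mfs) : v = (v : fpoly L) *: fs.
Proof. by rewrite -[RHS]/((v : fpoly L) * 1) mulr1. Qed.

Record is_Ds_module (act : {poly 'D[K] A} -> Mfs -> Mfs) : Prop := IsDsModule {
  Ds_act1 : forall v, act 1 v = v;
  Ds_actM : forall d e v, act (d * e) v = act d (act e v);
  Ds_actDl : forall d e v, act (d + e) v = act d v + act e v;
  Ds_actDr : forall d v w, act d (v + w) = act d v + act d w;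
  Ds_act_phi : forall (t : int) d v,
    phi t (act d v) = loc_act f d.[t%:~R] (phi t v)
}.

Lemma phiD t v w : phi t (v + w) = phi t v + phi t w.
Proof. by rewrite /phi fevalD mulrDl. Qed.

Lemma phi0 t : phi t 0 = 0.
Proof. by rewrite /phi feval0 mul0r. Qed.

Lemma phi_sum t (I : Type) (s : seq I) (P : pred I) (F : I -> Mfs) :
  phi t (\sum_(j <- s | P j) F j) = \sum_(j <- s | P j) phi t (F j).
Proof. by apply: (big_morph (phi t)) => [v w|]; [exact: phiD | exact: phi0]. Qed.

Lemma loc_scalar_int (t : int) : loc_scalar t%:~R = t%:~R.
Proof. exact: rmorph_int. Qed.

Lemma phiZ t (h : fpoly L) v : phi t (h *: v) = feval h t%:~R * phi t v.
Proof. by rewrite /phi -[h *: v]/(h * (v : fpoly L)) fevalM mulrA. Qed.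

Lemma feval_scalar (b : {poly K}) (t : int) :
  feval (fmap loc_scalar b) t%:~R = loc_scalar b.[t%:~R].
Proof. by rewrite -loc_scalar_int feval_map. Qed.

Lemma feval_scalarX k (t : int) : feval (fmap loc_scalar 'X^k) t%:~R = t%:~R ^+ k.
Proof.
by rewrite feval_scalar hornerXn rmorphXn; congr (_ ^+ _); exact: loc_scalar_int.
Qed.

Lemma locf_exp_inj t (x y : L) : locf_exp f t * x = locf_exp f t * y -> x = y.
Proof.
case: t => n /=; first exact: locf_inj.
by move=> H; rewrite -[x](locfK n.+1) H locfK.
Qed.

Hypothesis charK : [pchar K] =i pred0.

Lemma natK_eq0 n : ((n%:R : K) == 0) = (n == 0)%N.
Proof. by move/pcharf0P: charK => ->. Qed.

Lemma phi_inj0 (v : Mfs) : (forall t, phi t v = 0) -> v = 0.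
Proof.
move=> H; have [n Hn] := fpolyP (v : fpoly L).
have ev0 (t : nat) : \sum_(k < n) (v : fpoly L) k * t%:R ^+ k = 0.
  rewrite -(fevalE _ Hn); apply: (@locf_exp_inj t).
  by rewrite mulr0 mulrC -(H t).
pose V := Vandermonde n (\row_(t < n) (t%:R : K)).
have Vu : V \in unitmx.
  rewrite unitmxE det_Vandermonde unitfE; apply/prodf_neq0 => i _.
  apply/prodf_neq0 => j lt_ij; rewrite !mxE -natrB; last exact: ltnW.
  by rewrite natK_eq0 subn_eq0 -ltnNge.
apply: fpoly_ext => k; rewrite [RHS](_ : _ = 0); last by rewrite /=; case: eqP.
have [/Hn //|lt_kn] := leqP n k.
pose k0 := Ordinal lt_kn.
transitivity (\sum_(i < n) (v : fpoly L) i * loc_scalar ((V *m invmx V) i k0)).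
  rewrite mulmxV // (bigD1 k0) //= !mxE eqxx rmorph1 mulr1 big1 ?addr0 // => i ne_ik.
  by rewrite mxE (negbTE ne_ik) rmorph0 mulr0.
transitivity (\sum_(t < n) loc_scalar (invmx V t k0) *
    \sum_(i < n) (v : fpoly L) i * t%:R ^+ i).
  under eq_bigr => i _ do rewrite mxE rmorph_sum big_distrr.
  rewrite exchange_big; apply: eq_bigr => t _; rewrite big_distrr.
  apply: eq_bigr => i _; rewrite !mxE rmorphM rmorphXn rmorph_nat.
  by rewrite /= mulrA mulrC.
by apply: big1 => t _; rewrite ev0 mulr0.
Qed.

Lemma phi_inj v w : (forall t, phi t v = phi t w) -> v = w.
Proof.
move=> H; apply/eqP; rewrite -subr_eq0; apply/eqP; apply: phi_inj0 => t.
by apply: (addIr (phi t w)); rewrite -phiD subrK add0r H.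
Qed.

(* s (s - 1) ... (s - j + 1) / j! *)
Fixpoint binp (j : nat) : {poly K} :=
  if j is j'.+1 then (j'.+1)%:R^-1 *: (binp j' * ('X - j'%:R%:P)) else 1.

Lemma binpS j x : (binp j.+1).[x] = (binp j).[x] * (x - j%:R) / j.+1%:R.
Proof. by rewrite /= hornerZ hornerM hornerXsubC mulrC. Qed.

Lemma binp_0 j : (binp j).[0] = (j == 0)%:R.
Proof.
elim: j => [|j IH]; first by rewrite hornerC.
by rewrite binpS IH; case: j {IH} => [|j]; rewrite ?subr0 ?mulr0 !mul0r.
Qed.

Lemma binp_diff j x : (binp j.+1).[x + 1] = (binp j.+1).[x] + (binp j).[x].
Proof.
have nz i : (i.+1%:R : K) != 0 by rewrite natK_eq0.
have H : (binp j.+1).[x + 1] = (x + 1) * (binp j).[x] / j.+1%:R.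
  elim: j => [|j IH].
    by rewrite binpS hornerC hornerC subr0 mul1r mulr1.
  have e : x + 1 - j.+1%:R = x - j%:R by rewrite -natr1; ring.
  rewrite binpS IH binpS e; set u := j.+1%:R^-1; set w := j.+2%:R^-1.
  by ring.
rewrite H binpS -[X in _ = _ + X](mulfK (nz j)) -mulrDl; congr (_ / _).
by rewrite -natr1; ring.
Qed.

Local Notation g := (locf f).
Local Notation gi := (locfV f).
Local Notation ad := (fun E : L -> L => opcomm E g).

Lemma diffop_power n (E : L -> L) : (forall x y, E (x + y) = E x + E y) ->
  order_lt n E -> forall x t, E (x * locf_exp f t) = locf_exp f t *
    \sum_(j < n) loc_scalar (binp j).[t%:~R] * (gi ^+ j * iter j ad E x).
Proof.
elim: n E => [E _ -> x t|n IH E ED En x]; first by rewrite big_ord0 mulr0.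
pose S (t : int) := \sum_(j < n.+1)
  loc_scalar (binp j).[t%:~R] * (gi ^+ j * iter j ad E x).
pose G t := E (x * locf_exp f t) - locf_exp f t * S t.
have step t : G (t + 1) = g * G t.
  have H1 : E (x * locf_exp f (t + 1)) = g * E (x * locf_exp f t) +
      locf_exp f t * \sum_(j < n) loc_scalar (binp j).[t%:~R] *
        (gi ^+ j * iter j.+1 ad E x).
    under eq_bigr => j _ do rewrite iterSr.
    rewrite -(IH _ (opcomm_additive _ ED) (En g)) opcommE locf_expS mulrCA.
    by rewrite addrC subrK.
  have H2 : g * S (t + 1) = g * S t + \sum_(j < n) loc_scalar (binp j).[t%:~R] *
        (gi ^+ j * iter j.+1 ad E x).
    rewrite /S !big_ord_recl /= !hornerC !mulrDr -addrA.
    congr (_ + _); rewrite !big_distrr -big_split; apply: eq_bigr => j _.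
    rewrite /bump /= add1n intrD binp_diff rmorphD mulrDl mulrDr; congr (_ + _).
    by rewrite mulrCA exprS -mulrA [g * (gi * _)]mulrA locfVK mul1r.
  rewrite /G H1 locf_expS -[g * _ * _]mulrA [g * (_ * S _)]mulrCA H2.
  by rewrite mulrDr mulrBr opprD [g * (_ * S t)]mulrCA addrACA subrr addr0.
have G0 : G 0 = 0.
  rewrite /G /S /= !mulr1 mul1r big_ord_recl /= hornerC rmorph1 !mul1r.
  rewrite big1 ?addr0 ?subrr // => j _.
  by rewrite -[LHS]/(loc_scalar (binp j.+1).[0] * _) binp_0 rmorph0 mul0r.
suff G0t t : G t = 0 by move=> t; apply/eqP; rewrite -subr_eq0; apply/eqP; exact: G0t.
case: t => k.
  elim: k => // k IHk; have -> : Posz k.+1 = Posz k + 1 by rewrite -addn1 PoszD.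
  by rewrite step IHk mulr0.
elim: k => [|k IHk]; apply: (@locf_inj _ f 1); rewrite expr1 -step mulr0 //.
by have -> : Negz k.+1 + 1 = Negz k by rewrite !NegzE -[k.+2]addn1 PoszD opprD subrK.
Qed.

Lemma loc_act_poly (d : 'D[K] A) (x : L) :
  exists p : Mfs, forall t, phi t p = loc_act f d (x * locf_exp f t).
Proof.
have [[[ED _] [n En]] _] := loc_actP f d.
exists (\sum_(j < n) fmap loc_scalar (binp j) *:
  (fconst (gi ^+ j * iter j ad (loc_act f d) x) *: fs)) => t.
rewrite (diffop_power ED En) big_distrr phi_sum; apply: eq_bigr => j _.
by rewrite phiZ phiE feval_const feval_scalar mulrA mulrC.
Qed.

Definition loc_actr (x : L) (d : 'D[K] A) : L := loc_act f d x.
Fact loc_actr_is_zmod_morphism x : zmod_morphism (loc_actr x).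
Proof.
move=> d e; apply: (addIr (loc_actr x e)); rewrite subrK.
by rewrite /loc_actr -loc_actD subrK.
Qed.
HB.instance Definition _ x := GRing.isZmodMorphism.Build _ _ (loc_actr x)
  (loc_actr_is_zmod_morphism x).

Lemma loc_act_int (t : int) x : loc_act f t%:~R x = t%:~R * x.
Proof. by rewrite -[LHS]/(loc_actr x _) raddfMz mulrzl; congr (_ *~ _); exact: loc_act1. Qed.

Lemma loc_act_intX (t : int) k x : loc_act f (t%:~R ^+ k) x = t%:~R ^+ k * x.
Proof.
elim: k x => [|k IH] x; first by rewrite !expr0 loc_act1 mul1r.
by rewrite exprS loc_actM IH loc_act_int exprS mulrA.
Qed.

Lemma loc_act_horner (d : {poly 'D[K] A}) (t : int) x :
  loc_act f d.[t%:~R] x = \sum_(k < size d) loc_act f d`_k (t%:~R ^+ k * x).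
Proof.
rewrite horner_coef -[LHS]/(loc_actr x _) raddf_sum; apply: eq_bigr => k _.
by rewrite -[LHS]/(loc_act f (d`_k * t%:~R ^+ k) x) loc_actM loc_act_intX.
Qed.

Lemma loc_act_sum (d : 'D[K] A) (I : Type) (s : seq I) (P : pred I) (F : I -> L) :
  loc_act f d (\sum_(j <- s | P j) F j) = \sum_(j <- s | P j) loc_act f d (F j).
Proof.
apply: (big_morph (loc_act f d)) => [x y|]; first exact: loc_act_additive.
by apply: (addrI (loc_act f d 0)); rewrite -loc_act_additive !addr0.
Qed.

Lemma loc_act_intXr (d : 'D[K] A) (t : int) k x :
  loc_act f d (t%:~R ^+ k * x) = t%:~R ^+ k * loc_act f d x.
Proof.
have [[[_ dZ] _] _] := loc_actP f d.
have -> : (t%:~R ^+ k : L) = loc_scalar (t%:~R ^+ k).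
  by rewrite rmorphXn; congr (_ ^+ _); exact: (esym (loc_scalar_int t)).
exact: dZ.
Qed.

Lemma Ds_act_step (d : {poly 'D[K] A}) (v : Mfs) :
  exists w : Mfs, forall t, phi t w = loc_act f d.[t%:~R] (phi t v).
Proof.
have [n Hn] := fpolyP (v : fpoly L).
have /choice[p Hp] : forall k : nat, exists p : nat -> Mfs, forall i t,
    phi t (p i) = loc_act f d`_k ((v : fpoly L) i * locf_exp f t).
  move=> k; have /choice[p Hp] := fun i => loc_act_poly d`_k ((v : fpoly L) i).
  by exists p.
exists (\sum_(k < size d) \sum_(i < n) fmap loc_scalar 'X^(k + i) *: p k i) => t.
rewrite loc_act_horner phi_sum; apply: eq_bigr => k _.
rewrite phi_sum {2}/phi (fevalE _ Hn) big_distrl big_distrr loc_act_sum.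
apply: eq_bigr => i _; rewrite phiZ Hp feval_scalarX.
rewrite -loc_act_intXr exprD; congr (loc_act f _ _).
by rewrite /=; ring.
Qed.

Lemma Ds_module_exists : exists act, is_Ds_module act.
Proof.
have /choice[act0 H0] : forall d, exists a : Mfs -> Mfs, forall v t,
    phi t (a v) = loc_act f d.[t%:~R] (phi t v).
  by move=> d; have /choice[a Ha] := Ds_act_step d; exists a.
exists act0; split=> [v|d e v|d e v|d v w|t d v].
- by apply: phi_inj => t; rewrite H0 hornerC loc_act1.
- apply: phi_inj => t; rewrite !H0 -loc_actM hornerM_comm //.
  by rewrite /comm_poly; apply/commr_sym; exact: commr_int.
- by apply: phi_inj => t; rewrite phiD !H0 hornerD loc_actD.
- by apply: phi_inj => t; rewrite phiD !H0 phiD loc_act_additive.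
- exact: H0.
Qed.

Lemma Ds_module_uniq act act' : is_Ds_module act -> is_Ds_module act' ->
  forall d v, act d v = act' d v.
Proof. by move=> H H' d v; apply: phi_inj => t; rewrite !Ds_act_phi. Qed.

(* the unique module structure of Ds_module_exists and Ds_module_uniq *)
Definition Ds_act : {poly 'D[K] A} -> Mfs -> Mfs := sval (cid Ds_module_exists).

Lemma Ds_actP : is_Ds_module Ds_act.
Proof. exact: svalP (cid Ds_module_exists). Qed.

End BernsteinSato.

Arguments Ds_act {K A} f charK d v.
Arguments loc_scalar {K A} f c.
Arguments fs {K A} f.

(* Main.v *)
(* The specializations phi_t, t an integer, are jointly injective in
   characteristic zero, and phi_t turns the left hand identity into the right
   hand one. *)
Require Import Defs.
From HB Require Import structures.
From mathcomp Require Import all_boot all_order all_algebra.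

Set Implicit Arguments.
Unset Strict Implicit.
Unset Printing Implicit Defensive.

Import Order.TTheory GRing.Theory Num.Theory.

Local Open Scope ring_scope.

(** If all [phi t] kill h(s) [fs], then h vanishes at every integer, as f is a unit in A_f;
    invertible Vandermonde matrices over [K] then force h = 0. This is [phi_inj]. *)

Theorem proposition2p14 (K : fieldType) (charK : [pchar K] =i pred0)
    (A : comAlgType K) (noethA : noetherian A)
    (hA : finitely_generated A \/ complete_local A)
    (f : A) (delta : {poly 'D[K] A}) (b : {poly K}) :
  Ds_act f charK delta (fconst (locf f) *: fs f) = fmap (loc_scalar f) b *: fs f
  <->
  forall t : int,
    loc_act f delta.[t%:~R] (locf_exp f (t + 1)) =
    loc_scalar f b.[t%:~R] * locf_exp f t.
Proof.
have lhsE t : phi t (Ds_act f charK delta (fconst (locf f) *: fs f)) =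
    loc_act f delta.[t%:~R] (locf_exp f (t + 1)).
  (* The action commutes with specialization, and the constant factor f turns f^t into f^(t+1). *)
  by rewrite (Ds_act_phi (Ds_actP f charK)) phiE feval_const locf_expS.
have rhsE t : phi t (fmap (loc_scalar f) b *: fs f) =
    loc_scalar f b.[t%:~R] * locf_exp f t.
  by rewrite phiE feval_scalar.
split=> [eq_v t|eq_phi]; first by rewrite -lhsE eq_v rhsE.
(* Negative t included, the specializations jointly separate points. *)
by apply: (phi_inj charK) => t; rewrite lhsE rhsE.
Qed.
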